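(* For $f(x):=\|x\|_2^2$ on $\mathbb{R}^n$, and any positive integer $k<n$, it holds that $$g(x)\ge\frac2k\qquad\text{for all }x\in\Delta_n\text{ with }\mathrm{card}(x)\le k.$$
   Context: $\Delta_n:=\{x\in\mathbb{R}^n : x\ge0,\ \|x\|_1=1\}$ is the unit simplex, and $\mathrm{card}(x)$ denotes the number of non-zero coordinates of $x$. The duality gap of a differentiable convex $f$ over $\Delta_n$ at $x\in\Delta_n$ is $$g(x):=\max_{y\in\Delta_n}(x-y)^T\nabla f(x)=x^T\nabla f(x)-\min_i(\nabla f(x))_i .$$ *)

(* Defs.v *)
From HB Require Import structures.
From mathcomp Require Import all_boot all_order all_algebra.
From mathcomp Require Import all_classical all_reals all_analysis.

Set Implicit Arguments.
Unset Strict Implicit.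
Unset Printing Implicit Defensive.

Import Order.TTheory GRing.Theory Num.Theory.
Import numFieldNormedType.Exports.

Local Open Scope classical_set_scope.
Local Open Scope ring_scope.

(* The norm `|x| that the library puts on 'rV[R]_n is the sup norm, hence the
   explicit l1 and l2 norms. *)
Definition l1norm (R : realType) (n : nat) (x : 'rV[R]_n) : R :=
  \sum_(i < n) `|x 0 i|.

Definition l2norm (R : realType) (n : nat) (x : 'rV[R]_n) : R :=
  Num.sqrt (\sum_(i < n) x 0 i ^+ 2).

Definition dot (R : realType) (n : nat) (u v : 'rV[R]_n) : R :=
  \sum_(i < n) u 0 i * v 0 i.

Definition unit_simplex (R : realType) (n : nat) : set 'rV[R]_n :=
  [set x : 'rV[R]_n | (forall i, 0 <= x 0 i) /\ l1norm x = 1].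

Definition nnz (R : realType) (n : nat) (x : 'rV[R]_n) : nat :=
  #|[pred i | x 0 i != 0]|.

Definition gradient (R : realType) (n : nat) (f : 'rV[R]_n -> R)
    (x : 'rV[R]_n) : 'rV[R]_n :=
  \row_i 'D_(delta_mx 0 i) f x.

(* For 0 < n this supremum is a maximum: see [duality_gap_max]. *)
Definition duality_gap (R : realType) (n : nat) (f : 'rV[R]_n -> R)
    (x : 'rV[R]_n) : R :=
  sup [set dot (x - y) (gradient f x) | y in @unit_simplex R n].

Lemma duality_gap_max (R : realType) (n : nat) (f : 'rV[R]_n -> R)
    (x : 'rV[R]_n) : (0 < n)%N ->
  (exists2 y, unit_simplex y & duality_gap f x = dot (x - y) (gradient f x)) /\
  (forall y, unit_simplex y -> dot (x - y) (gradient f x) <= duality_gap f x).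
Proof.
case: n f x => // n f x _.
rewrite /duality_gap; set g := gradient f x.
pose i0 := [arg min_(i < (ord0 : 'I_n.+1)) g 0 i]%O.
have i0P j : g 0 i0 <= g 0 j by rewrite /i0; case: arg_minP => // i _; apply.
pose e : 'rV[R]_n.+1 := delta_mx 0 i0.
have eS : unit_simplex e.
  split=> [i|]; first by rewrite mxE ler0n.
  rewrite /l1norm (bigD1 i0) //= big1 ?addr0 => [|i /negPf ii0].
    by rewrite mxE !eqxx normr1.
  by rewrite mxE ii0 andbF normr0.
have dotB y : dot (x - y) g = dot x g - dot y g.
  rewrite /dot -sumrB; apply: eq_bigr => i _.
  by rewrite !mxE mulrBl.
have dote : dot e g = g 0 i0.
  rewrite /dot (bigD1 i0) //= big1 ?addr0 => [|i /negPf ii0].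
    by rewrite mxE !eqxx mul1r.
  by rewrite mxE ii0 andbF mul0r.
have ub y : unit_simplex y -> dot (x - y) g <= dot (x - e) g.
  move=> [y0 y1]; rewrite !dotB lerD2l lerN2 dote.
  rewrite -[leLHS]mul1r -y1 /l1norm mulr_suml; apply: ler_sum => i _.
  by rewrite ger0_norm // ler_wpM2l.
pose A := [set dot (x - y) g | y in @unit_simplex R n.+1].
have ubA : ubound A (dot (x - e) g) by move=> _ [y yS <-]; exact: ub.
have Ae : A (dot (x - e) g) by exists e.
have supA : sup A = dot (x - e) g.
  apply/eqP; rewrite eq_le; apply/andP; split.
    by apply: ge_sup => //; exists (dot (x - e) g).
  by apply: ub_le_sup => //; exists (dot (x - e) g).
by rewrite -/A supA; split; [exists e | exact: ub].
Qed.

(* Main.v *)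
Require Import Defs.
From HB Require Import structures.
From mathcomp Require Import all_boot all_order all_algebra.
From mathcomp Require Import all_classical all_reals all_analysis.
From mathcomp Require Import ring lra.

(** Since [x] has at most [k < n] non-zero coordinates, some coordinate [x 0 i]
    vanishes.  The gradient of the squared Euclidean norm at [x] is [2 x]
    ([gradient_sqr_l2norm]), so the vertex [e_i] of the simplex is orthogonal to
    it, and testing the duality gap against [y = e_i] gives at least
    [x^T (2 x) = 2 |x|^2].  It remains to see that a point of the simplex with
    at most [k] non-zero coordinates satisfies [1/k <= |x|^2]
    ([inv_le_sumsq]): mass one spread over at most [k] coordinates has the
    smallest sum of squares when it is spread evenly over exactly [k]. *)

Set Implicit Arguments.
Unset Strict Implicit.
Unset Printing Implicit Defensive.

Import Order.TTheory GRing.Theory Num.Theory.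
Import numFieldNormedType.Exports.

Local Open Scope classical_set_scope.
Local Open Scope ring_scope.

Lemma sqr_l2norm (R : realType) (n : nat) (x : 'rV[R]_n) :
  l2norm x ^+ 2 = \sum_(i < n) x 0 i ^+ 2.
Proof. by rewrite sqr_sqrtr // sumr_ge0 // => i _; rewrite sqr_ge0. Qed.

Lemma sqr_l2norm_shift (R : realType) (n : nat) (x : 'rV[R]_n) (i : 'I_n)
    (h : R) :
  l2norm (h *: delta_mx 0 i + x) ^+ 2 - l2norm x ^+ 2 = h * (h + 2 * x 0 i).
Proof.
rewrite !sqr_l2norm -sumrB (bigD1 i) //= big1 => [|j /negPf ji].
  by rewrite !mxE !eqxx /=; ring.
by rewrite !mxE ji andbF mulr0 add0r subrr.
Qed.

(** Along a coordinate axis the squared norm is quadratic, so its difference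
    quotient at a non-zero [h] is exactly [h + 2 * x 0 i]: no error term has to
    be estimated. *)
Lemma gradient_sqr_l2norm (R : realType) (n : nat) (x : 'rV[R]_n) :
  gradient (fun z : 'rV[R]_n => l2norm z ^+ 2) x = 2 *: x.
Proof.
apply/rowP => i; rewrite !mxE /derive; apply: cvg_lim => //.
have lin : (h + 2 * x 0 i) @[h --> (0 : R)^'] --> 2 * x 0 i.
  rewrite -[X in _ --> X]add0r; apply: cvgD; last exact: cvg_cst.
  exact: nbhs_dnbhs.
apply: cvg_trans lin; apply: near_eq_cvg; near=> h.
have h0 : h != 0 by near: h; exact: nbhs_dnbhs_neq.
by rewrite /= sqr_l2norm_shift /GRing.scale /= mulKf.
Unshelve. all: by end_near. Qed.

(** The square lies above its tangent line at [k^-1], the common value of the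
    coordinates in the even spread: [2 / k * t - k^-1 ^+ 2 <= t ^+ 2].  Summing
    this over the support loses the constant at most [k] times, whence
    [2 / k - 1 / k] as a lower bound. *)
Lemma inv_le_sumsq (R : realType) (n k : nat) (x : 'rV[R]_n) :
  (0 < k)%N -> unit_simplex x -> (nnz x <= k)%N ->
  k%:R^-1 <= \sum_(i < n) x 0 i ^+ 2.
Proof.
move=> k_gt0 [x_ge0 x_sum1] x_card.
have k_neq0 : k%:R != 0 :> R by rewrite pnatr_eq0 -lt0n.
pose c : R := k%:R^-1; rewrite -/c.
have sumx : \sum_(i < n) x 0 i = 1.
  by rewrite -x_sum1; apply: eq_bigr => i _; rewrite ger0_norm.
have tangent i : 2 * c * x 0 i - c ^+ 2 * (x 0 i != 0)%:R <= x 0 i ^+ 2.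
  have [->|_] := eqVneq (x 0 i) 0; first by rewrite !mulr0 subr0 expr0n.
  by have := sqr_ge0 (x 0 i - c); rewrite mulr1; nra.
apply: le_trans (ler_sum _ (fun i _ => tangent i)).
rewrite sumrB -!mulr_sumr sumx -natr_sum mulr1.
have -> : (\sum_(i < n) (x 0%R i != 0%R) = nnz x)%N.
  rewrite /nnz -sum1_card [RHS]big_mkcond; apply: eq_bigr => i _.
  by rewrite inE; case: eqP.
have : c ^+ 2 * (nnz x)%:R <= c.
  have {2}-> : c = c ^+ 2 * k%:R by rewrite expr2 mulfVK.
  by rewrite ler_wpM2l ?sqr_ge0 // ler_nat.
lra.
Qed.

Lemma exists_zero_coord (R : realType) (n : nat) (x : 'rV[R]_n) :
  (nnz x < n)%N -> exists i, x 0 i = 0.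
Proof.
rewrite ltnNge => x_card; apply: contrapT => x_neq0.
have x_full : [pred i | x 0 i != 0] =i 'I_n.
  by move=> i; rewrite !inE; apply/eqP => xi0; apply: x_neq0; exists i.
by move: x_card; rewrite /nnz (eq_card x_full) card_ord leqnn.
Qed.

Lemma delta_unit_simplex (R : realType) (n : nat) (i : 'I_n) :
  unit_simplex (delta_mx 0 i : 'rV[R]_n).
Proof.
split=> [j|]; first by rewrite mxE ler0n.
rewrite /l1norm (bigD1 i) //= big1 => [|j /negPf ji].
  by rewrite mxE !eqxx normr1 addr0.
by rewrite mxE ji andbF normr0.
Qed.

Theorem lemma11 (R : realType) (n k : nat) (hk : (0 < k)%N) (hkn : (k < n)%N)
    (x : 'rV[R]_n) (hx : unit_simplex x) (hcard : (nnz x <= k)%N) :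
  2 / k%:R <= duality_gap (fun z : 'rV[R]_n => l2norm z ^+ 2) x.
Proof.
have n_gt0 : (0 < n)%N by exact: leq_ltn_trans hkn.
have [i xi0] : exists i, x 0 i = 0.
  exact/exists_zero_coord/(leq_ltn_trans hcard).
have [_ gap_ge] := duality_gap_max (fun z : 'rV[R]_n => l2norm z ^+ 2) x n_gt0.
apply: le_trans (gap_ge _ (delta_unit_simplex R i)).
rewrite gradient_sqr_l2norm.
have -> : dot (x - delta_mx 0 i) (2 *: x) = 2 * \sum_(j < n) x 0 j ^+ 2.
  rewrite mulr_sumr; apply: eq_bigr => j _; rewrite !mxE eqxx /=.
  by have [->|_] := eqVneq j i; rewrite ?xi0 /=; ring.
by rewrite ler_wpM2l // (inv_le_sumsq hk hx hcard).
Qed.
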